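(* Let $R$ be a ring and let $I\subseteq J(R)$ be an ideal of $R$. Then $R$ is a 2-$\Delta U$ ring if and only if $R/I$ is a 2-$\Delta U$ ring.
   Context: Rings are associative with identity, not necessarily commutative. $U(R)$ is the group of units of $R$ and $J(R)$ the Jacobson radical. $\Delta(R)=\{r\in R : r+U(R)\subseteq U(R)\}$. A ring $R$ is called 2-$\Delta U$ if $u^2\in 1+\Delta(R)$ for every $u\in U(R)$ (equivalently, the square of each unit is a sum of an idempotent and an element of $\Delta(R)$). *)

(* Defs.v *)
From HB Require Import structures.
From mathcomp Require Import all_boot all_order all_algebra.

Set Implicit Arguments.
Unset Strict Implicit.
Unset Printing Implicit Defensive.

Import GRing.Theory.

Local Open Scope ring_scope.
Local Open Scope quotient_scope.

(* Rings are [pzRingType]s: associative, unital, not necessarily commutative,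
   the zero ring being allowed. As in [ring_quotient], ideals are boolean
   predicates, which is no restriction in classical logic. *)

(* [ring_quotient] only equips quotients of commutative rings with a ring
   structure, and its [idealr] is one-sided and proper by definition; hence the
   following two-sided ideals, which need not be proper, and their quotients. *)
HB.mixin Record isTwoSidedIdeal (R : pzRingType) (S : R -> bool) := {
  ideal2Ml : forall a u : R, S u -> S (a * u);
  ideal2Mr : forall a u : R, S u -> S (u * a)
}.

#[short(type="ideal2")]
HB.structure Definition TwoSidedIdeal (R : pzRingType) :=
  {S of GRing.ZmodClosed R S & isTwoSidedIdeal R S}.

Definition ring_quot (R : pzRingType) (I : ideal2 R) : Type := Quotient.quot I.

Notation "R / I" := (@ring_quot R I) : type_scope.

Section RingQuot.
Variables (R : pzRingType) (I : ideal2 R).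

HB.instance Definition _ := GRing.Zmodule.copy (ring_quot I) (Quotient.quot I).
HB.instance Definition _ := EqQuotient.copy (ring_quot I) (Quotient.quot I).

Definition rq_one : R / I := \pi_(R / I) 1.
Definition rq_mul (x y : R / I) : R / I := \pi_(R / I) (repr x * repr y).

Lemma pi_eqE (x y : R) : (\pi_(R / I) x == \pi_(R / I) y) = (x - y \in I).
Proof. by rewrite (Quotient.idealrBE I). Qed.

Lemma rq_mulE (x y : R) :
  rq_mul (\pi_(R / I) x) (\pi_(R / I) y) = \pi_(R / I) (x * y).
Proof.
apply/eqP; rewrite pi_eqE.
set x' := repr _; set y' := repr _.
have Ix : x' - x \in I by rewrite -pi_eqE reprK.
have Iy : y' - y \in I by rewrite -pi_eqE reprK.
rewrite -[x' * y'](subrK (x' * y)) -addrA -mulrBr -mulrBl rpredD //.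
  exact: ideal2Ml.
exact: ideal2Mr.
Qed.

Lemma rq_addE (x y : R) :
  \pi_(R / I) x + \pi_(R / I) y = \pi_(R / I) (x + y).
Proof. exact: esym (Quotient.pi_add I x y). Qed.

Lemma rq_mulA : associative rq_mul.
Proof.
by elim/quotW=> x; elim/quotW=> y; elim/quotW=> z; rewrite (rq_mulE y z) (rq_mulE x y) !rq_mulE mulrA.
Qed.

Lemma rq_mul1l : left_id rq_one rq_mul.
Proof. by elim/quotW=> x; rewrite rq_mulE mul1r. Qed.

Lemma rq_mul1r : right_id rq_one rq_mul.
Proof. by elim/quotW=> x; rewrite rq_mulE mulr1. Qed.

Lemma rq_mulDl : left_distributive rq_mul +%R.
Proof.
elim/quotW=> x; elim/quotW=> y; elim/quotW=> z.
by rewrite rq_addE (rq_mulE x z) (rq_mulE y z) rq_mulE rq_addE mulrDl.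
Qed.

Lemma rq_mulDr : right_distributive rq_mul +%R.
Proof.
elim/quotW=> x; elim/quotW=> y; elim/quotW=> z.
by rewrite rq_addE (rq_mulE x y) (rq_mulE x z) rq_mulE rq_addE mulrDr.
Qed.

HB.instance Definition _ := GRing.Zmodule_isPzRing.Build (ring_quot I)
  rq_mulA rq_mul1l rq_mul1r rq_mulDl rq_mulDr.

Lemma rq_pi_is_zmod_morphism : zmod_morphism (\pi_(R / I) : R -> R / I).
Proof. by move=> x y; exact: (raddfB (\pi_(Quotient.quot I))). Qed.

Lemma rq_pi_is_monoid_morphism : monoid_morphism (\pi_(R / I) : R -> R / I).
Proof. by split=> // x y; rewrite -rq_mulE. Qed.

End RingQuot.

Section Notions.
Variable R : pzRingType.

Definition is_unit (u : R) : Prop := exists v : R, v * u = 1 /\ u * v = 1.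

(* Left ideals are the submodules of R as a left module R^o over itself. *)
Definition left_ideal (M : {pred R}) : Prop :=
  GRing.submod_closed (M : {pred R^o}).

Definition maximal_left_ideal (M : {pred R}) : Prop :=
  [/\ left_ideal M, 1 \notin M &
      forall N : {pred R}, left_ideal N -> 1 \notin N ->
        {subset M <= N} -> {subset N <= M}].

(* The intersection of all maximal left ideals. *)
Definition in_jacobson (x : R) : Prop :=
  forall M : {pred R}, maximal_left_ideal M -> x \in M.

Definition in_Delta (r : R) : Prop := forall u : R, is_unit u -> is_unit (r + u).

Definition two_DeltaU : Prop :=
  forall u : R, is_unit u -> exists2 d : R, in_Delta d & u ^+ 2 = 1 + d.

End Notions.

Arguments two_DeltaU R%_type : clear implicits.

(* Main.v *)
Require Import Defs.
From mathcomp Require Import all_boot all_order all_algebra.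
From mathcomp Require Import boolp classical_sets.

Set Implicit Arguments.
Unset Strict Implicit.
Unset Printing Implicit Defensive.

Import GRing.Theory.

Local Open Scope ring_scope.
Local Open Scope quotient_scope.

(** Every element of 1 + I is a unit because I lies in the Jacobson radical, so
    units lift along R -> R / I: an element is a unit as soon as its class is
    one. Hence membership in Delta can be tested modulo I as well, and so can
    the condition u ^+ 2 - 1 \in Delta. *)

Section Krull.
Variable R : pzRingType.
Implicit Types M N : {pred R}.

(** Zorn's lemma for the left ideals that contain [M] and avoid [1], preordered by inclusion: the
    union of a chain still avoids [1]. *)
Lemma left_ideal_sub_maximal M : left_ideal M -> 1 \notin M ->
  exists2 N, maximal_left_ideal N & {subset M <= N}.
Proof.
move=> lM M1.
pose T := {N : {pred R} | [/\ left_ideal N, 1 \notin N & {subset M <= N}]}.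
pose t0 : T := exist _ M (And3 lM M1 (fun _ => id)).
pose le (s t : T) := `[< {subset sval s <= sval t} >].
have t0_min s : le t0 s by apply/asboolP; case: (svalP s).
have le_refl s : le s s by apply/asboolP.
have le_trans r s t : le r s -> le s t -> le r t.
  by move=> /asboolP rs /asboolP st; apply/asboolP => x /rs /st.
have [A totA|[N [lN N1 MN]] maxN] := ZL_preorder t0 le_refl le_trans.
  (* Adding the least element [t0] makes the chain nonempty. *)
  pose B s := A s \/ s = t0.
  have totB s t : B s -> B t -> le s t \/ le t s.
    by case=> [As|->]; [case=> [At|->]|]; auto.
  pose U : {pred R} := fun x => `[< exists2 s, B s & x \in sval s >].
  have UP x : reflect (exists2 s, B s & x \in sval s) (x \in U).
    exact: asboolP.
  have B0 : B t0 by right.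
  suff PU : [/\ left_ideal U, 1 \notin U & {subset M <= U}].
    by exists (exist _ U PU) => s As; apply/asboolP => x xs;
       apply/UP; exists s => //; left.
  split; first split.
  - by apply/UP; exists t0 => //; have [M0 _] := lM.
  - move=> a u v /UP[s Bs us] /UP[t Bt vt]; apply/UP.
    have [/asboolP st|/asboolP ts] := totB s t Bs Bt.
      by exists t => //; case: (svalP t) => -[_ lt _ _]; apply/lt/vt/st.
    by exists s => //; case: (svalP s) => -[_ ls _ _]; apply/ls/ts.
  - by apply/negP => /UP[s _]; apply/negP; case: (svalP s).
  - by move=> x Mx; apply/UP; exists t0.
exists N => //; split=> // N' lN' N'1 NN'.
have PN' : [/\ left_ideal N', 1 \notin N' & {subset M <= N'}].
  by split=> // x /MN /NN'.
by have /asboolP := maxN (exist _ N' PN') (asboolT NN').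
Qed.

(** Otherwise the left ideal [R (1 + x)] is proper and lies in a maximal one, which also contains
    [x], hence [1]. *)
Lemma in_jacobson_left_inv (x : R) : in_jacobson x ->
  exists v : R, v * (1 + x) = 1.
Proof.
move=> Jx; apply: contrapT => no_inv.
pose M : {pred R} := fun y => `[< exists v, v * (1 + x) = y >].
have MP y : reflect (exists v, v * (1 + x) = y) (y \in M) by exact: asboolP.
have lM : left_ideal M.
  split; first by apply/MP; exists 0; rewrite mul0r.
  move=> a _ _ /MP[v <-] /MP[w <-]; apply/MP.
  by exists (a * v + w); rewrite mulrDl -mulrA.
have [|N maxN MN] := left_ideal_sub_maximal lM; first exact/MP.
have [[_ linN] /negP N1 _] := maxN; apply: N1.
have Nx1 : 1 + x \in N by apply/MN/MP; exists 1; rewrite mul1r.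
by have := linN (-1) _ _ (Jx _ maxN) Nx1; rewrite scaleN1r addrCA addNr addr0.
Qed.

End Krull.

Section Units.
Variable R : pzRingType.

Lemma left_right_inv_unit (x y z : R) : x * y = 1 -> y * z = 1 -> is_unit y.
Proof.
move=> xy yz; exists x; split=> //.
by rewrite -[x]mulr1 -yz (mulrA x) xy mul1r yz.
Qed.

(** An inverse of [v * u] yields a left inverse of [u], and one of [u * v] a right inverse. *)
Lemma is_unit_mulr_mull (u v : R) :
  is_unit (v * u) -> is_unit (u * v) -> is_unit u.
Proof.
move=> [x [xvu _]] [y [_ uvy]].
by apply: (@left_right_inv_unit (x * v) _ (v * y)); rewrite -?mulrA // mulrA.
Qed.

End Units.

Section Quotient.
Variables (R : pzRingType) (I : ideal2 R).
Hypothesis I_sub_J : forall x : R, x \in I -> in_jacobson x.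

Local Notation pi := (\pi_(R / I)).

(** A left inverse [v] of [1 + x] equals [1 - v * x] and [v * x] is again in [I], so [v] has a left
    inverse [w] too; then [w = w * v * (1 + x) = 1 + x], and [v] is a two-sided inverse. *)
Lemma is_unit_1D (x : R) : x \in I -> is_unit (1 + x).
Proof.
move=> Ix; have [v vx] := in_jacobson_left_inv (I_sub_J Ix).
have vE : v = 1 + - (v * x) by rewrite -vx mulrDr mulr1 addrK.
have [|w] := @in_jacobson_left_inv _ (- (v * x)).
  by apply: I_sub_J; rewrite rpredN; exact: ideal2Ml.
rewrite -vE => wv; exists v; split=> //.
by rewrite -[1 + x]mul1r -{1}wv -!mulrA (mulrA v) vx mul1r.
Qed.

Lemma rq_piM (x y : R) : pi (x * y) = pi x * pi y.
Proof. exact/esym/rq_mulE. Qed.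

(** If [v] lifts an inverse of [pi u], then [u * v] and [v * u] lie in [1 + I] and are units. *)
Lemma is_unit_pi (u : R) : is_unit (pi u) <-> is_unit u.
Proof.
split=> [[w]|[v [vu uv]]]; last first.
  by exists (pi v); rewrite -!rq_piM vu uv.
elim/quotW: w => v [vu uv].
have unit_of_pi1 x : pi x = 1 -> is_unit x.
  move=> /eqP x1; rewrite -[x](subrK 1) addrC; apply: is_unit_1D.
  by rewrite -pi_eqE.
by apply: (@is_unit_mulr_mull _ u v); apply: unit_of_pi1;
  rewrite rq_piM.
Qed.

(** The units of [R / I] are exactly the classes of units of [R], so both sides test the same
    elements [u]. *)
Lemma in_Delta_pi (r : R) : in_Delta (pi r) <-> in_Delta r.
Proof.
split=> Dr u; first by move/is_unit_pi/Dr; rewrite rq_addE => /is_unit_pi.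
by elim/quotW: u => u /is_unit_pi/Dr ru; rewrite rq_addE; apply/is_unit_pi.
Qed.

End Quotient.

(** The witness [d] can only be [u ^+ 2 - 1]; naming it leaves an expression that commutes with the
    projection. *)
Lemma two_DeltaUE (R : pzRingType) :
  two_DeltaU R <-> forall u : R, is_unit u -> in_Delta (u ^+ 2 - 1).
Proof.
split=> H u /H => [[d Dd ->]|Du]; first by rewrite addrC addrA addNr add0r.
by exists (u ^+ 2 - 1) => //; rewrite addrC subrK.
Qed.

Theorem theorem3p10 (R : pzRingType) (I : ideal2 R)
    (I_sub_J : forall x : R, x \in I -> in_jacobson x) :
  two_DeltaU R <-> two_DeltaU (R / I).
Proof.
have piE (u : R) : \pi_(R / I) u ^+ 2 - 1 = \pi_(R / I) (u ^+ 2 - 1).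
  by rewrite (rq_pi_is_zmod_morphism I) !expr2 rq_piM.
rewrite !two_DeltaUE; split=> H u; last first.
  by move=> /(is_unit_pi I_sub_J)/H; rewrite piE => /(in_Delta_pi I_sub_J).
elim/quotW: u => u /(is_unit_pi I_sub_J)/H Du.
by rewrite piE; apply/(in_Delta_pi I_sub_J).
Qed.
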